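(* Let $\omega$ be an open set in $\mathbb{R}^d$ with smooth boundary and let $V\in C_b(\mathbb{R}^d)$. Assume that there exist $T>0$, $h_0=h_0(\omega,V,T)>0$ and $C=C(\omega,V,T)>0$ such that, for every $0<h\le h_0$ and every $u_F\in\ell^2(h\mathbb{Z}^d)$, the solution $u$ of $$\partial_t u=-\Delta_h u+Vu,\quad (t,x)\in(0,\infty)\times h\mathbb{Z}^d,\qquad u(T,x)=u_F(x),\quad x\in h\mathbb{Z}^d,$$ satisfies the observability inequality $$\|u(0,\cdot)\|_{\ell^2(h\mathbb{Z}^d)}^2\le C\int_0^T\|u(t,\cdot)\|_{\ell^2(\omega)}^2\,\mathrm{d}t+Ce^{-C/h^2}\|u(T)\|_{\ell^2(h\mathbb{Z}^d)}^2.$$ Then $\omega$ is thick.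
   Context: For $h>0$ and $u$ a function on $h\mathbb{Z}^d$, $\Delta_h u(x)=h^{-2}\sum_{j=1}^d\bigl(u(x+he_j)+u(x-he_j)-2u(x)\bigr)$. Norms: $\|u\|_{\ell^2(h\mathbb{Z}^d)}^2=\sum_{x\in h\mathbb{Z}^d}|u(x)|^2$ and $\|u\|_{\ell^2(\omega)}^2=\sum_{x\in\omega\cap h\mathbb{Z}^d}|u(x)|^2$. The real-valued bounded continuous potential $V$ acts by multiplication by its restriction to $h\mathbb{Z}^d$. An open set $\omega\subset\mathbb{R}^d$ with smooth boundary is thick if there exist $L>0$ and $\gamma\in(0,1]$ such that $|\omega\cap(x+[-L/2,L/2]^d)|\ge\gamma L^d$ for every $x\in\mathbb{R}^d$, where $|\cdot|$ is Lebesgue measure. *)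

(* Defs.v *)
Set Warnings "-notation-overridden,-notation-incompatible-prefix,-ambiguous-paths".
From mathcomp Require Import all_boot all_order all_algebra.
From mathcomp Require Import complex.
From mathcomp Require Import all_classical all_reals all_analysis.

Set Implicit Arguments.
Unset Strict Implicit.
Unset Printing Implicit Defensive.

Import Order.TTheory GRing.Theory Num.Theory.
Import numFieldNormedType.Exports.

Local Open Scope classical_set_scope.
Local Open Scope ring_scope.
Local Open Scope complex_scope.

Definition basis_vec (R : realType) (d : nat) (j : 'I_d) : 'rV[R]_d :=
  delta_mx 0 j.

(* The normed space 'rV[R]_d carries the sup norm, which gives R^d its usual
   topology. *)

Fixpoint Ck_on (R : realType) (d : nat) (U : set 'rV[R]_d) (k : nat)
    (f : 'rV[R]_d -> R) : Prop :=
  (forall x, U x -> {for x, continuous f}) /\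
  match k with
  | 0%N => True
  | k'.+1 => forall j : 'I_d,
      (forall x, U x -> derivable f x (basis_vec R j)) /\
      Ck_on U k' (fun x => 'D_(basis_vec R j) f x)
  end.

Definition smooth_on (R : realType) (d : nat) (U : set 'rV[R]_d)
    (f : 'rV[R]_d -> R) : Prop :=
  forall k, Ck_on U k f.

Definition boundary (T : topologicalType) (A : set T) : set T :=
  closure A `\` interior A.

(* Near each boundary point, the set lies on one side of a smooth hypersurface
   given by a local defining function with nonzero gradient. *)
Definition smooth_boundary (R : realType) (d : nat) (omega : set 'rV[R]_d)
    : Prop :=
  forall p, boundary omega p ->
    exists (U : set 'rV[R]_d) (phi : 'rV[R]_d -> R),
      [/\ open U, U p, smooth_on U phi,
          exists j : 'I_d, 'D_(basis_vec R j) phi p != 0 &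
          omega `&` U = [set x | phi x < 0] `&` U].

(* Lebesgue outer measure on R^d, from countable covers by closed boxes. It is
   Lebesgue measure on Borel sets, and [thick] only uses it on the intersection
   of an open set with a closed cube. *)
Definition lebesgue_vol (R : realType) (d : nat) (A : set 'rV[R]_d) : \bar R :=
  ereal_inf [set s : \bar R |
    exists a b : nat -> 'rV[R]_d,
      [/\ forall n j, a n 0 j <= b n 0 j,
          A `<=` \bigcup_n [set x | forall j, a n 0 j <= x 0 j <= b n 0 j] &
          s = (\sum_(0 <= n <oo) (\prod_(j < d) (b n 0 j - a n 0 j))%:E)%E]].

Definition cube (R : realType) (d : nat) (x : 'rV[R]_d) (L : R)
    : set 'rV[R]_d :=
  [set y | forall j, x 0 j - L / 2 <= y 0 j <= x 0 j + L / 2].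

Definition thick (R : realType) (d : nat) (omega : set 'rV[R]_d) : Prop :=
  exists L gamma : R,
    [/\ 0 < L, 0 < gamma <= 1 &
        forall x, ((gamma * L ^+ d)%:E <= lebesgue_vol (omega `&` cube x L))%E].

(* The grid h Z^d inside R^d. Functions on the grid are represented by
   functions on all of R^d; everything below looks only at their values at
   grid points. *)
Definition grid (R : realType) (d : nat) (h : R) : set 'rV[R]_d :=
  [set x | exists k : 'rV[int]_d, x = h *: map_mx intr k].

Definition discrete_laplacian (R : realType) (d : nat) (h : R)
    (u : 'rV[R]_d -> R[i]) (x : 'rV[R]_d) : R[i] :=
  (h ^- 2)%:C * \sum_(j < d) (u (x + h *: basis_vec R j)
                              + u (x - h *: basis_vec R j) - 2 * u x).

(* The squared norm in l^2(omega), with value +oo when the sum diverges;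
   omega = setT gives the norm of l^2(h Z^d). *)
Definition l2normsq (R : realType) (d : nat) (h : R) (omega : set 'rV[R]_d)
    (u : 'rV[R]_d -> R[i]) : \bar R :=
  \esum_(x in omega `&` grid h) ((Normc.normc (u x)) ^+ 2)%:E.

Definition in_l2 (R : realType) (d : nat) (h : R) (u : 'rV[R]_d -> R[i])
    : Prop :=
  (l2normsq h setT u < +oo)%E.

Definition is_cderive (R : realType) (f : R -> R[i]) (t : R) (z : R[i])
    : Prop :=
  is_derive t 1 (fun s => complex.Re (f s) : R) (complex.Re z) /\
  is_derive t 1 (fun s => complex.Im (f s) : R) (complex.Im z).

(* u is in C([0, oo); l^2(h Z^d)), solves the equation at every (t, x) in
   (0, oo) x h Z^d, and takes the value uF at time T. Membership in
   C([0, oo); l^2) is what singles out "the" solution, since pointwise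
   solutions on an infinite grid need not be unique, and it links u(0) to
   positive times. *)
Definition is_solution (R : realType) (d : nat) (h : R) (V : 'rV[R]_d -> R)
    (T : R) (uF : 'rV[R]_d -> R[i]) (u : R -> 'rV[R]_d -> R[i]) : Prop :=
  [/\ forall t, 0 <= t -> in_l2 h (u t),
      forall t, 0 <= t ->
        l2normsq h setT (fun x => u s x - u t x)
          @[s --> within [set s | 0 <= s] (nbhs t)] --> 0%E,
      forall t x, 0 < t -> grid h x ->
        is_cderive (fun s => u s x) t
          (- discrete_laplacian h (u t) x + (V x)%:C * u t x) &
      forall x, grid h x -> u T x = uF x].

Definition observable (R : realType) (d : nat) (h : R) (omega : set 'rV[R]_d)
    (T C : R) (u : R -> 'rV[R]_d -> R[i]) : Prop :=
  (l2normsq h setT (u 0%R) <=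
    C%:E * \int[lebesgue_measure]_(t in `[0%R, T]) l2normsq h omega (u t)
    + (C * expR (- C / h ^+ 2))%:E * l2normsq h setT (u T))%E.

(* Main.v *)
Set Warnings "-notation-overridden,-notation-incompatible-prefix,-ambiguous-paths".
Require Import Defs.
From mathcomp Require Import all_boot all_order all_algebra.
From mathcomp Require Import complex finmap zify ring lra.
From mathcomp Require Import all_classical all_reals all_analysis.

Import Order.TTheory GRing.Theory Num.Theory.
Import numFieldNormedType.Exports.

Local Open Scope classical_set_scope.
Local Open Scope ring_scope.

Set Implicit Arguments.
Unset Strict Implicit.
Unset Printing Implicit Defensive.

(** The converse of observability is tested on one explicit datum.  For a centre
    c let phi = peak c be the product over the coordinates of
    1 / (1 + (x_j - c_j)^2).  This profile is chosen because its discrete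
    Laplacian is controlled by the profile itself, |Lap_h phi| <= 4 d phi, for
    every mesh h ([peak_lap]).  Hence phi is at once a sub- and a supersolution
    of the (backward) heat equation, up to exponential factors: if u solves
    the equation with u(T) = phi then, with |V| <= m and for t <= T,

      exp(-(m + 4d)(T-t)) phi <= u(t) <= exp((m + 4d)(T-t)) phi

    ([flow_bounds]), with constants that do not depend on h or c.  The solution
    is built as an exponential series: adding the constant q = 2d/h^2 + m to
    Lap_h - V gives a positive operator Q ([hop]), and phi is nearly an
    eigenvector of Q, so that all iterates of Q on phi are squeezed between
    multiples of phi.

    Put into the observability inequality, the bounds say that omega carries a
    fixed fraction of the sum of phi^2 over the grid as soon as the error term
    C exp(-C/h^2) is small ([observed_mass]).  That sum is at least of order
    h^-d, while the part outside a large cube around c is at most a small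
    multiple of h^-d.  So for some L and gamma > 0 the set omega meets every cube
    of side L in at least gamma h^-d grid points, for all small h and all
    centres ([observable_density]).

    It remains to let h go to 0 for a fixed cube and to compare the number of
    grid points with the volume.  A box contains at most its volume times
    h^-d grid points, asymptotically, and so does a finite union of boxes.  The
    volume is defined by countable covers of omega and the cube, so compactness
    must be used, on the closure of omega: this is where the boundary enters.
    Near a boundary point omega is { f < 0 } with a partial derivative of f bounded
    below, so a line in that direction meets the open neighbourhood
    { |f| < eta } of the boundary in a short piece only, and that
    neighbourhood contains few grid points
    ([smooth_boundary_locally_thin]).  Outside such a neighbourhood, finitely
    many slightly enlarged boxes of the cover suffice
    ([density_le_lebesgue_vol]). *)

(** * The one-dimensional profile *)

(** The profile decays only polynomially, so that its second difference is
    comparable with it; it is still summable over a grid. *)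
Definition profile (R : realType) (y : R) : R := (1 + y ^+ 2)^-1.

Section Profile.
Context {R : realType}.
Implicit Types y h : R.

Lemma profile_den_gt0 y : 0 < 1 + y ^+ 2 :> R.
Proof. by have := sqr_ge0 y; lra. Qed.

Lemma profile_gt0 y : 0 < profile y.
Proof. by rewrite invr_gt0 profile_den_gt0. Qed.

Lemma profile_le1 y : profile y <= 1.
Proof. by rewrite invf_le1 ?profile_den_gt0// lerDl sqr_ge0. Qed.

(** With D = (1 + (y+h)^2)(1 + (y-h)^2), the second difference is
    2 h^2 (3 y^2 - 1 - h^2) / D times the profile, and D dominates
    1 + 2 h^2 + 2 y^2 because D minus that is the square of y^2 - h^2.  The
    bound holds for every h. *)
Lemma profile_lap y h :
  `|profile (y + h) + profile (y - h) - 2 * profile y| <= 4 * h ^+ 2 * profile y.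
Proof.
pose D := (1 + (y + h) ^+ 2) * (1 + (y - h) ^+ 2).
have Dlb : 1 + 2 * h ^+ 2 + 2 * y ^+ 2 <= D.
  have -> : D = 1 + 2 * h ^+ 2 + 2 * y ^+ 2 + (y ^+ 2 - h ^+ 2) ^+ 2.
    by rewrite /D; ring.
  by rewrite lerDl sqr_ge0.
have h2 := sqr_ge0 h; have y2 := sqr_ge0 y.
have D0 : 0 < D by lra.
have -> : profile (y + h) + profile (y - h) - 2 * profile y =
    2 * h ^+ 2 * (3 * y ^+ 2 - 1 - h ^+ 2) / D * profile y.
  rewrite /D /profile; field.
  by rewrite !gt_eqF ?profile_den_gt0.
rewrite normrM (gtr0_norm (profile_gt0 y)) ler_pM2r ?profile_gt0//.
rewrite normrM normfV (gtr0_norm D0) ler_pdivrMr// normrM ger0_norm; last lra.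
have : `|3 * y ^+ 2 - 1 - h ^+ 2| <= 2 * D by rewrite ler_norml; lra.
by nra.
Qed.

(* A bounded increasing function whose increments dominate h times the profile:
   a rational stand-in for the primitive arctan. *)
Let G y := y / (1 + `|y|).

Let G_le1 y : `|G y| <= 1.
Proof.
rewrite /G normrM normfV (ger0_norm (_ : 0 <= 1 + `|y|)); last by rewrite addr_ge0.
by rewrite ler_pdivrMr ?ltr_pwDl// mul1r lerDr.
Qed.

Let profile_telescope y h : 0 < h <= 1 ->
  h * profile y <= 4 * (G (y + h) - G y).
Proof.
move=> /andP[h0 h1]; have y2 := profile_den_gt0 y.
rewrite /profile -ler_pdivlMr ?invr_gt0// invrK /G.
(* The increment of y / (1 + |y|) has a different closed form according to the
   signs of y and y + h. *)
have [y0|y0] := leP 0 y.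
  rewrite !ger0_norm//; last lra.
  have -> : (y + h) / (1 + (y + h)) - y / (1 + y) = h / ((1 + (y + h)) * (1 + y)).
    by field; apply/andP; split; apply/eqP; lra.
  have D0 : 0 < (1 + (y + h)) * (1 + y) by nra.
  rewrite mulrA [leRHS]mulrAC ler_pdivlMr// (mulrC 4) -!mulrA ler_pM2l//.
  have := sqr_ge0 (y - 1); nra.
have [yh|yh] := leP 0 (y + h).
  rewrite (ger0_norm yh) (ltr0_norm y0).
  have -> : (y + h) / (1 + (y + h)) - y / (1 - y) =
    ((y + h) * (1 - y) - y * (1 + (y + h))) / ((1 + (y + h)) * (1 - y)).
    by field; apply/andP; split; apply/eqP; lra.
  have D0 : 0 < (1 + (y + h)) * (1 - y) by nra.
  rewrite mulrA [leRHS]mulrAC ler_pdivlMr//.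
  have key (a b : R) : 0 <= a -> 0 < b -> a <= 1 -> b <= 1 ->
      (a + b) * ((1 + a) * (1 + b)) <=
      4 * (a * (1 + b) + b * (1 + a)) * (1 + b ^+ 2).
    move=> a0 b0 a1 b1; have ab : 0 <= a * b by nra.
    have A : (1 + a) * (1 + b) <= 4 by nra.
    apply: (@le_trans _ _ ((a + b) * 4)); first by rewrite ler_wpM2l//; lra.
    by have := sqr_ge0 b; nra.
  have := key (y + h) (- y) yh; rewrite sqrrN mulNr.
  have -> : y + h + - y = h by ring.
  by apply; lra.
rewrite !ltr0_norm//.
have -> : (y + h) / (1 - (y + h)) - y / (1 - y) = h / ((1 - (y + h)) * (1 - y)).
  by field; apply/andP; split; apply/eqP; lra.
have D0 : 0 < (1 - (y + h)) * (1 - y) by nra.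
rewrite mulrA [leRHS]mulrAC ler_pdivlMr// (mulrC 4) -!mulrA ler_pM2l//.
have := sqr_ge0 (y + 1); nra.
Qed.

(** The sum telescopes against a function with values in [-1, 1], so the bound
    depends on neither the length of the sum nor its starting point. *)
Lemma profile_sum y h (n : nat) : 0 < h <= 1 ->
  \sum_(i < n) profile (h * i%:R + y) <= 8 / h.
Proof.
move=> /[dup] h01 /andP[h0 h1].
rewrite ler_pdivlMr// mulr_suml.
have : \sum_(i < n) profile (h * i%:R + y) * h <=
       \sum_(i < n) (4 * (G (h * i.+1%:R + y) - G (h * i%:R + y))).
  apply: ler_sum => i _; rewrite mulrC.
  have -> : h * i.+1%:R + y = h * i%:R + y + h by rewrite -[i.+1%:R]natr1; ring.
  exact: profile_telescope.
move/le_trans; apply.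
rewrite -mulr_sumr -(big_mkord predT (fun i => G (h * i.+1%:R + y) - G (h * i%:R + y))).
rewrite telescope_sumr//.
have := G_le1 (h * n%:R + y); have := G_le1 (h * 0 + y).
by rewrite !ler_norml; lra.
Qed.

End Profile.

(** * The test datum and the hopping operator *)

Definition peak (R : realType) (d : nat) (c x : 'rV[R]_d) : R :=
  \prod_(j < d) profile (x 0 j - c 0 j).

(** Lap_h f + (2d/h^2 + W) f: the discrete Laplacian and a potential, with the
    diagonal shifted so that all coefficients are nonnegative when W is. *)
Definition hop (R : realType) (d : nat) (h : R) (W f : 'rV[R]_d -> R)
    (x : 'rV[R]_d) : R :=
  h ^- 2 * \sum_(j < d) (f (x + h *: basis_vec R j) + f (x - h *: basis_vec R j))
  + W x * f x.

Section Peak.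
Context {R : realType} {d : nat}.
Implicit Types (x c : 'rV[R]_d) (h : R).

Lemma peak_gt0 c x : 0 < peak c x.
Proof. by apply: prodr_gt0 => j _; exact: profile_gt0. Qed.

Lemma peak_le1 c x : peak c x <= 1.
Proof. by apply: prodr_ile1 => j _; rewrite ltW ?profile_gt0// profile_le1. Qed.

(** Each of the d second differences acts on one factor only. *)
Lemma peak_lap c x h :
  `|\sum_(j < d) (peak c (x + h *: basis_vec R j)
     + peak c (x - h *: basis_vec R j)) - 2 * d%:R * peak c x|
  <= 4 * d%:R * h ^+ 2 * peak c x.
Proof.
have -> : 2 * d%:R * peak c x = \sum_(j < d) 2 * peak c x.
  by rewrite sumr_const card_ord -mulr_natr; ring.
have -> : 4 * d%:R * h ^+ 2 * peak c x = \sum_(j < d) 4 * h ^+ 2 * peak c x.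
  by rewrite sumr_const card_ord -[RHS]mulr_natr; ring.
rewrite -sumrB (le_trans (ler_norm_sum _ _ _))//; apply: ler_sum => j _.
have shift (e : R) : peak c (x + e *: basis_vec R j) =
    profile (x 0 j - c 0 j + e) * \prod_(i < d | i != j) profile (x 0 i - c 0 i).
  rewrite /peak (bigD1 j)//=; congr (profile _ * _).
    by rewrite !mxE !eqxx mulr1 addrAC.
  by apply: eq_bigr => i ij; rewrite !mxE (negbTE ij) mulr0 addr0.
rewrite -scaleNr !shift [peak c x](bigD1 j)//=.
set p := \prod_(i < d | _) _; have p0 : 0 < p.
  by apply: prodr_gt0 => i _; exact: profile_gt0.
have := profile_lap (x 0 j - c 0 j) h.
set u := profile (_ + h); set v := profile (_ - h); set w := profile _ => uvw.
have -> : u * p + v * p - 2 * (w * p) = (u + v - 2 * w) * p by ring.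
by rewrite normrM (gtr0_norm p0) [leRHS]mulrA ler_pM2r.
Qed.

End Peak.

Section HopSemigroup.
Context {R : realType} {d : nat}.
Variables (h : R) (W : 'rV[R]_d -> R).
Hypothesis W_ge0 : forall x, 0 <= W x.
Implicit Types (f g phi : 'rV[R]_d -> R).

Local Notation Q := (hop h W).

Lemma hop_linear a f g x : Q (fun y => a * f y + g y) x = a * Q f x + Q g x.
Proof.
rewrite /hop; set S := \sum_(j < d) _.
have -> : S = a * \sum_(j < d) (f (x + h *: basis_vec R j) + f (x - h *: basis_vec R j))
  + \sum_(j < d) (g (x + h *: basis_vec R j) + g (x - h *: basis_vec R j)).
  by rewrite mulr_sumr -big_split; apply: eq_bigr => j _ /=; ring.
by ring.
Qed.

Lemma hop_scale a f x : Q (fun y => a * f y) x = a * Q f x.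
Proof.
rewrite /hop mulrDr [W x * _]mulrCA; congr (_ + _).
rewrite [RHS]mulrCA; congr (_ * _); rewrite mulr_sumr.
by apply: eq_bigr => j _; rewrite mulrDr.
Qed.

Lemma hop_mono f g : (forall x, f x <= g x) -> forall x, Q f x <= Q g x.
Proof.
move=> fg x; rewrite lerD//; last by rewrite ler_wpM2l.
rewrite ler_wpM2l ?invr_ge0 ?sqr_ge0//.
by apply: ler_sum => j _; rewrite lerD.
Qed.

Lemma hop_cvg (F : nat -> 'rV[R]_d -> R) f :
  (forall x, F n x @[n --> \oo] --> f x) ->
  forall x, Q (F n) x @[n --> \oo] --> Q f x.
Proof.
move=> Ff x; apply: cvgD; last by apply: cvgMl_tmp.
by apply: cvgMl_tmp; apply: cvg_big; [exact: add_continuous|move=> j _; exact: cvgD].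
Qed.

End HopSemigroup.

(** * The exponential of the hopping operator *)

Definition hop_coeff (R : realType) (d : nat) (h : R) (W f : 'rV[R]_d -> R)
    (x : 'rV[R]_d) : R^nat :=
  fun n => iter n (hop h W) f x / n`!%:R.

(** exp(s Q) f at the point x.  The series is taken pointwise.  Negative s
    occur, since the equation is also imposed at times beyond T. *)
Definition hop_exp (R : realType) (d : nat) (h : R) (W f : 'rV[R]_d -> R)
    (s : R) (x : 'rV[R]_d) : R :=
  limn (pseries (hop_coeff h W f x) s).

Section HopExponential.
Context {R : realType} {d : nat}.
Variables (h : R) (W phi : 'rV[R]_d -> R) (al be : R).
Hypothesis W_ge0 : forall x, 0 <= W x.
Hypothesis phi_ge0 : forall x, 0 <= phi x.
Hypothesis al_ge0 : 0 <= al.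
Hypothesis be_ge0 : 0 <= be.
Hypothesis hop_phi : forall x, al * phi x <= hop h W phi x <= be * phi x.
Implicit Types (f g : 'rV[R]_d -> R) (s : R).

Local Notation Q := (hop h W).

Definition dominated (B : R) f := 0 <= B /\ forall x, `|f x| <= B * phi x.

Lemma dominated_hop B f : dominated B f -> dominated (B * be) (Q f).
Proof.
move=> [B0 fB]; split=> [|x]; first exact: mulr_ge0.
have up y : f y <= B * phi y by rewrite (le_trans _ (fB y)) ?ler_norm.
have lo y : - B * phi y <= f y.
  by rewrite mulNr lerNl (le_trans _ (fB y))// -normrN ler_norm.
have := hop_mono h W_ge0 up x; have := hop_mono h W_ge0 lo x.
rewrite !hop_scale; have /andP[_] := hop_phi x.
move=> /(ler_wpM2l B0); rewrite mulrA ler_norml; lra.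
Qed.

Lemma dominated_iter n B f : dominated B f -> dominated (B * be ^+ n) (iter n Q f).
Proof.
move=> fB; elim: n => [|n ih]; first by rewrite expr0 mulr1.
by rewrite exprSr mulrA; exact: dominated_hop.
Qed.

(** Positivity of Q turns the one-step lower bound into a bound on iterates;
    this is where al >= 0 matters. *)
Lemma hop_iter_ge n x : al ^+ n * phi x <= iter n Q phi x.
Proof.
elim: n x => [|n ih] x; first by rewrite expr0 mul1r.
apply: (@le_trans _ _ (Q (fun y => al ^+ n * phi y) x)); last first.
  by rewrite /=; apply: hop_mono.
rewrite hop_scale exprSr -mulrA ler_wpM2l ?exprn_ge0//.
by have /andP[] := hop_phi x.
Qed.

Let coeff_le B f s x n : dominated B f ->
  `|hop_coeff h W f x n * s ^+ n| <= B * phi x * exp_coeff (be * `|s|) n.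
Proof.
move=> fB; have [_ /(_ x)] := dominated_iter n fB.
rewrite normrM /hop_coeff normrM normfV normrX normr_nat => iB.
rewrite /exp_coeff/= exprMn.
rewrite (_ : B * phi x * _ = B * be ^+ n * phi x * (n`!%:R^-1 * `|s| ^+ n)); last by ring.
by rewrite -mulrA ler_wpM2r// mulr_ge0 ?invr_ge0.
Qed.

Let is_cvg_dom (B s : R) x :
  cvgn (series (fun n => B * phi x * exp_coeff (be * `|s|) n)).
Proof.
exact: (@is_cvg_seriesZ R (exp_coeff _) _ (is_cvg_series_exp_coeff _)).
Qed.

Let is_cvg_norm B f s x : dominated B f ->
  cvgn [normed series (fun n => hop_coeff h W f x n * s ^+ n)].
Proof.
move=> fB; apply: (@series_le_cvg _ _ (fun n => B * phi x * exp_coeff (be * `|s|) n)).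
- by move=> n; exact: normr_ge0.
- by move=> n; apply: le_trans (coeff_le s x n fB).
- by move=> n; exact: coeff_le.
- exact: is_cvg_dom.
Qed.

Lemma is_cvg_hop_exp B f s x : dominated B f -> cvgn (pseries (hop_coeff h W f x) s).
Proof. by move=> fB; apply: normed_cvg; exact: is_cvg_norm fB. Qed.

Lemma hop_exp_le B f s x : dominated B f ->
  `|hop_exp h W f s x| <= expR (be * `|s|) * (B * phi x).
Proof.
move=> fB; rewrite /hop_exp /pseries.
apply: (le_trans (lim_series_norm (is_cvg_norm fB))).
rewrite mulrC -[leRHS](@lim_seriesZ R (exp_coeff _) _ (is_cvg_series_exp_coeff _)).
apply: lim_series_le; [exact: is_cvg_norm fB | exact: is_cvg_dom |].
by move=> n; exact: coeff_le.
Qed.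

Lemma dominated_phi : dominated 1 phi.
Proof. by split=> // x; rewrite mul1r ger0_norm. Qed.

Lemma hop_exp_ge s x : 0 <= s -> expR (al * s) * phi x <= hop_exp h W phi s x.
Proof.
move=> s0.
rewrite mulrC -[leLHS](@lim_seriesZ R (exp_coeff _) _ (is_cvg_series_exp_coeff _)).
apply: lim_series_le.
- exact: (@is_cvg_seriesZ R (exp_coeff _) _ (is_cvg_series_exp_coeff _)).
- exact: is_cvg_hop_exp dominated_phi.
move=> n; rewrite -[leLHS]/(phi x * exp_coeff (al * s) n) /exp_coeff/= /hop_coeff.
rewrite exprMn (_ : phi x * _ = al ^+ n * phi x * (n`!%:R^-1 * s ^+ n)); last by ring.
rewrite -[leRHS]mulrA ler_wpM2r ?hop_iter_ge//.
by rewrite mulr_ge0 ?invr_ge0// exprn_ge0.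
Qed.

(** Q involves finitely many values of its argument, so it commutes with
    pointwise limits of the partial sums. *)
Lemma hop_exp_hop B f s x : dominated B f ->
  hop_exp h W (Q f) s x = Q (hop_exp h W f s) x.
Proof.
move=> fB; apply/cvg_lim => //.
have -> : pseries (hop_coeff h W (Q f) x) s =
    (fun N => Q (fun y => pseries (hop_coeff h W f y) s N) x).
  apply/funext; elim=> [|N ih].
    rewrite /pseries/= /series/= big_geq//.
    under [X in _ = Q X x]funext do rewrite big_geq// -(mulr0 0).
    by rewrite hop_scale mul0r.
  rewrite /pseries/= /series/= big_nat_recr//=.
  under [X in _ = Q X x]funext do rewrite big_nat_recr//= addrC /hop_coeff mulrAC mulrC mulrA.
  move: ih; rewrite /pseries/= /series/= => ->.
  rewrite [LHS]addrC.
  have := hop_linear h W (s ^+ N / N`!%:R) (iter N Q f)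
    (fun y => \sum_(0 <= k < N) hop_coeff h W f y k * s ^+ k) x.
  rewrite /hop_coeff -iterSr /= => H.
  have -> : Q (iter N Q f) x / N`!%:R * s ^+ N = s ^+ N / N`!%:R * Q (iter N Q f) x by ring.
  rewrite -H; congr (Q _ x); apply/funext => y; congr (_ + _).
  by ring.
by apply: hop_cvg => y; exact: is_cvg_hop_exp fB.
Qed.

(** Formal differentiation of the series replaces the coefficients of f by those
    of Q f, which obey the same kind of bound; so the term-by-term
    differentiation theorem applies. *)
Lemma is_derive_hop_exp B f s x : dominated B f ->
  is_derive s 1 (fun s => hop_exp h W f s x) (Q (hop_exp h W f s) x).
Proof.
move=> fB; rewrite -(hop_exp_hop s x fB).
have diffs g : pseries_diffs (hop_coeff h W g x) = hop_coeff h W (Q g) x.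
  apply/funext => n; rewrite /pseries_diffs /hop_coeff -iterSr factS natrM invfM.
  by rewrite mulrCA mulVKf// pnatr_eq0.
rewrite /hop_exp -diffs.
have QfB := dominated_hop fB.
apply: (@pseries_snd_diffs _ _ (`|s| + 1)).
- exact: is_cvg_hop_exp fB.
- by rewrite diffs; exact: is_cvg_hop_exp QfB.
- by rewrite !diffs; exact: is_cvg_hop_exp (dominated_hop QfB).
by rewrite [ltRHS]ger0_norm// ltrDl.
Qed.

End HopExponential.

(** * Sums over the grid *)

Lemma esum_le_finType (R : realType) (T : choiceType) (F : finType) (A : set T)
    (k : T -> F) (a : T -> R) (b : F -> R) :
  (forall x y, A x -> A y -> k x = k y -> x = y) -> (forall i, 0 <= b i) ->
  (forall x, A x -> a x <= b (k x)) ->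
  (\esum_(x in A) (a x)%:E <= (\sum_i b i)%:E)%E.
Proof.
move=> k_inj b0 ab; apply: ge_ereal_sup => _ [X [finX XA] <-].
rewrite fsbig_finite// sumEFin lee_fin.
have memX x : x \in fset_set X -> A x.
  by rewrite in_fset_set// inE => /XA.
apply: (@le_trans _ _ (\sum_(x <- fset_set X) b (k x))).
  by rewrite big_seq [leRHS]big_seq; apply: ler_sum => x /memX /ab.
rewrite -(big_map k predT b) big_uniq/=; last first.
  rewrite map_inj_in_uniq ?fset_uniq// => x y /memX Ax /memX Ay.
  exact: k_inj.
by rewrite [leRHS](bigID [in map k (fset_set X)])/= lerDl sumr_ge0.
Qed.

Section LatticePoints.
Context {R : realType} {d : nat}.
Implicit Types (x c : 'rV[R]_d) (h : R) (A : set 'rV[R]_d).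

Definition grid_coord h x (j : 'I_d) : int := Num.floor (x 0 j / h).

Lemma grid_coordE h x j : 0 < h -> grid h x -> x 0 j = h * (grid_coord h x j)%:~R.
Proof.
move=> h0 [k ->]; rewrite /grid_coord !mxE [h * _]mulrC mulfK ?gt_eqF//.
by rewrite intrKfloor mulrC.
Qed.

Lemma grid_coord_inj h x y : 0 < h -> grid h x -> grid h y ->
  (forall j, grid_coord h x j = grid_coord h y j) -> x = y.
Proof.
move=> h0 gx gy xy; apply/rowP => j.
by rewrite (grid_coordE j h0 gx) (grid_coordE j h0 gy) xy.
Qed.

(** A finite set of grid points lies in a box of side 2 N + 1, and the sum of
    a product over a box is the product of the one-dimensional sums. *)
Lemma grid_sum_peak_le h c : 0 < h <= 1 ->
  (\esum_(x in grid h) (peak c x)%:E <= ((8 / h) ^+ d)%:E)%E.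
Proof.
move=> /[dup] h01 /andP[h0 h1]; apply: ge_ereal_sup => _ [X [finX XA] <-].
rewrite -esum_fset//; last by move=> x _; rewrite lee_fin ltW ?peak_gt0.
pose N := (\max_(x <- fset_set X) \max_(j < d) `|grid_coord h x j|)%N.
have XN x j : X x -> (`|grid_coord h x j| <= N)%N.
  move=> Xx; have xX : x \in fset_set X by rewrite in_fset_set// inE.
  apply: (leq_trans (@leq_bigmax _ (fun j => `|grid_coord h x j|%N) j)).
  exact: (@leq_bigmax_seq _ _ predT (fun y => \max_(i < d) `|grid_coord h y i|%N) x).
have pos x j : X x -> (0 <= grid_coord h x j + N)%R.
  by move=> /XN => /(_ j); move: (grid_coord h x j) => z zN; lia.
pose k x : {ffun 'I_d -> 'I_(N + N).+1} :=
  [ffun j => inord `|(grid_coord h x j + N)%R|%N].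
have kE x j : X x -> (k x j)%:Z = grid_coord h x j + N.
  move=> Xx; rewrite ffunE inordK.
    by rewrite gez0_abs// pos.
  by have := XN _ j Xx; have := pos _ j Xx; move: (grid_coord h x j) => z; lia.
pose b (f : {ffun 'I_d -> 'I_(N + N).+1}) : R :=
  \prod_(j < d) profile (h * (f j)%:R + (- h * N%:R - c 0 j)).
apply: (@le_trans _ _ (\sum_f b f)%:E).
  apply: (@esum_le_finType _ _ _ _ k).
  - move=> x y Xx Xy kxy; apply: (grid_coord_inj h0 (XA _ Xx) (XA _ Xy)) => j.
    by apply: (@addIr _ N%:Z); rewrite -!kE// kxy.
  - by move=> f; apply: prodr_ge0 => j _; rewrite ltW ?profile_gt0.
  - move=> x Xx; rewrite le_eqVlt; apply/orP; left; apply/eqP.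
    apply: eq_bigr => j _; congr profile.
    have /(congr1 (fun z : int => z%:~R : R)) := kE _ j Xx.
    rewrite rmorphD/= => kR.
    rewrite (_ : (k x j)%:R = (grid_coord h x j)%:~R + N%:R :> R) ?[LHS]kR//.
    by rewrite (grid_coordE j h0 (XA _ Xx)); ring.
rewrite lee_fin /b -(bigA_distr_bigA
  (fun j (i : 'I_(N + N).+1) => profile (h * i%:R + (- h * N%:R - c 0 j)))).
rewrite -[X in _ <= _ ^+ X](card_ord d) -prodr_const; apply: ler_prod => j _.
rewrite profile_sum// andbT; apply: sumr_ge0 => i _.
by rewrite ltW ?profile_gt0.
Qed.

(** Reducing every integer coordinate modulo n_i, the integer part of
    l_i / h plus 1, is injective on the grid points of A: coordinates other
    than the j-th are determined because they vary by less than n_i h; once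
    these agree, both points lie on the same line in direction j, and the
    j-th coordinate is determined too.  With the full widths of a box this
    counts the points of a box; for a set that is merely short along the lines
    of one direction it is what makes neighbourhoods of hypersurfaces thin. *)
Lemma grid_count_le h A (j : 'I_d) (l : 'I_d -> R) : 0 < h ->
  (forall i, 0 <= l i) ->
  (forall x y, A x -> A y -> forall i, i != j -> `|x 0 i - y 0 i| <= l i) ->
  (forall x y, A x -> A y -> (forall i, i != j -> x 0 i = y 0 i) ->
     `|x 0 j - y 0 j| <= l j) ->
  (\esum_(x in A `&` grid h) 1 <= (\prod_i (l i / h + 1))%:E)%E.
Proof.
move=> h0 l0 Al Alj; pose n i := Num.truncn (l i / h).
have nE i : (n i).+1%:R <= l i / h + 1.
  by rewrite -natr1 lerD2r truncn_le divr_ge0// ltW.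
pose k x : {dffun forall i : 'I_d, 'I_(n i).+1} :=
  [ffun i => inord `|(grid_coord h x i %% (n i).+1)%Z|%N].
have kE x i : (k x i)%:Z = (grid_coord h x i %% (n i).+1)%Z.
  rewrite ffunE inordK; first by rewrite gez0_abs// modz_ge0.
  have : (grid_coord h x i %% (n i).+1 < (n i).+1)%Z by exact: ltz_pmod.
  have : (0 <= grid_coord h x i %% (n i).+1)%Z by exact: modz_ge0.
  by move: (modz _ _) => z; lia.
have same x y i : grid h x -> grid h y -> k x = k y ->
    `|x 0 i - y 0 i| <= l i -> grid_coord h x i = grid_coord h y i.
  move=> gx gy kxy; rewrite (grid_coordE i h0 gx) (grid_coordE i h0 gy).
  rewrite -mulrBr normrM gtr0_norm// mulrC -ler_pdivlMr// -intrB -intr_norm.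
  move=> /le_lt_trans /(_ (truncnS_gt _)).
  rewrite -/(n i) -[X in _ < X]/((n i).+1%:Z%:~R) ltr_int => lt_n.
  have : ((n i).+1 %| grid_coord h x i - grid_coord h y i)%Z.
    by rewrite -eqz_mod_dvd -!kE kxy.
  move: lt_n; move: (grid_coord h x i) (grid_coord h y i) => a b ab.
  move=> /dvdzP[q qE]; have : q = 0.
    by move: ab; rewrite qE normrM; nia.
  by move=> q0; move: qE; rewrite q0 mul0r => /eqP; rewrite subr_eq0 => /eqP.
have k_inj x y : (A `&` grid h) x -> (A `&` grid h) y -> k x = k y -> x = y.
  move=> [Ax gx] [Ay gy] kxy.
  have off i : i != j -> grid_coord h x i = grid_coord h y i.
    by move=> ij; apply: same => //; exact: Al.
  apply: (grid_coord_inj h0 gx gy) => i; have [->|] := eqVneq i j; last exact: off.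
  apply: same => //; apply: Alj => // i' /off.
  by rewrite (grid_coordE i' h0 gx) (grid_coordE i' h0 gy) => ->.
have := @esum_le_finType R _ _ _ k (fun=> 1) (fun=> 1) k_inj (fun=> ler01) (fun _ _ => lexx _).
move=> /le_trans; apply; rewrite lee_fin sumr_const card_dep_ffun.
rewrite foldrE big_map -big_enum/= natr_prod; apply: ler_prod => i _.
by rewrite card_ord ler0n nE.
Qed.

End LatticePoints.

Lemma profile_ge_half (R : realType) (y : R) : `|y| <= 1 -> 2^-1 <= profile y.
Proof.
move=> y1; rewrite /profile lef_pV2 ?posrE ?profile_den_gt0//.
have : `|y| ^+ 2 <= 1 by rewrite expr_le1.
by rewrite real_normK ?num_real//; lra.
Qed.

(** About 1/h consecutive grid values per coordinate lie within distance 1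
    of the centre, where every factor of phi is at least 1/2. *)
Lemma grid_sum_peak_sq_ge (R : realType) (d : nat) (h : R) (c : 'rV[R]_d) :
  0 < h <= 1 ->
  (((4 * h)^-1 ^+ d)%:E <= \esum_(x in grid h) (peak c x ^+ 2)%:E)%E.
Proof.
move=> /andP[h0 h1]; pose n := (Num.truncn h^-1).+1.
pose b j : int := Num.ceil ((c 0 j - 1) / h).
pose k (f : {ffun 'I_d -> 'I_n}) : 'rV[R]_d :=
  h *: map_mx intr (\row_j (b j + (f j)%:Z)).
have kE f j : k f 0 j = h * ((b j)%:~R + (f j)%:R) by rewrite !mxE rmorphD.
have k_inj : injective k.
  move=> f g /rowP fg; apply/ffunP => j; apply: val_inj => /=.
  have := fg j; rewrite !kE => /(mulfI (lt0r_neq0 h0))/addrI/eqP.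
  by rewrite eqr_nat => /eqP.
have kc f j : `|k f 0 j - c 0 j| <= 1.
  rewrite kE mulrDr.
  have /andP[] := ceil_itv ((c 0 j - 1) / h); rewrite -/(b j) intrB.
  rewrite ltr_pdivlMr// ler_pdivrMr// => blt ble.
  have fn : h * (f j)%:R <= 1.
    rewrite -ler_pdivlMl// mulr1.
    apply: (@le_trans _ _ (Num.truncn h^-1)%:R); last by rewrite truncn_le invr_ge0 ltW.
    by rewrite ler_nat -ltnS ltn_ord.
  have f0 : 0 <= h * (f j)%:R by rewrite mulr_ge0// ltW.
  by rewrite ler_norml; lra.
apply: esum_ge; exists [set` [fset k f | f in {ffun 'I_d -> 'I_n}]%fset].
  split=> [|x /= /imfsetP[f _ ->]]; first exact: finite_fset.
  by exists (\row_j (b j + (f j)%:Z)).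
rewrite fsbig_finite//= set_fsetK big_imfset/=; last by move=> f g _ _ /k_inj.
rewrite big_enum_cond/= sumEFin lee_fin.
apply: (@le_trans _ _ (\sum_(f : {ffun 'I_d -> 'I_n}) 4^-1 ^+ d)); last first.
  apply: ler_sum => f _; rewrite -[X in _ ^+ X](card_ord d) -prodr_const -prodrXl.
  apply: ler_prod => j _; rewrite invr_ge0 ler0n/=.
  have -> : 4^-1 = 2^-1 ^+ 2 :> R by field.
  have half := profile_ge_half (kc f j).
  have half0 : 0 <= 2^-1 :> R by rewrite invr_ge0.
  by apply: lerXn2r; rewrite ?nnegrE// (le_trans half0).
rewrite sumr_const card_ffun !card_ord -[leRHS]mulr_natl natrX -exprMn invfM mulrC.
apply: lerXn2r; rewrite ?nnegrE ?mulr_ge0 ?invr_ge0 ?ler0n ?(ltW h0)//.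
by rewrite ler_wpM2r ?invr_ge0 ?ler0n// ltW ?truncnS_gt.
Qed.

Lemma esum_subset (R : realType) (T : choiceType) (A B : set T) (a : T -> \bar R) :
  A `<=` B -> (\esum_(x in A) a x <= \esum_(x in B) a x)%E.
Proof.
move=> AB; apply: ge_ereal_sup => _ [X [finX XA] <-].
by apply: ereal_sup_ubound; exists X => //; split=> //; exact: subset_trans AB.
Qed.

Lemma esumZ (R : realType) (T : choiceType) (A : set T) (a : T -> R) (k : R) :
  0 <= k ->
  (\esum_(x in A) (k * a x)%:E = k%:E * \esum_(x in A) (a x)%:E)%E.
Proof.
have scale_le (r : R) (b : T -> R) : 0 < r ->
    (\esum_(x in A) (r * b x)%:E <= r%:E * \esum_(x in A) (b x)%:E)%E.
  move=> r0; apply: ge_ereal_sup => _ [X [finX XA] <-].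
  rewrite fsbig_finite// sumEFin -mulr_sumr EFinM -sumEFin -fsbig_finite//.
  by rewrite lee_pmul2l//; apply: ereal_sup_ubound; exists X.
rewrite le_eqVlt => /predU1P[<-|k0].
  by rewrite mul0e esum1// => x _; rewrite mul0r.
apply/eqP; rewrite eq_le scale_le//=.
rewrite -lee_pdivlMl//; apply: le_trans (scale_le k^-1 _ _); last by rewrite invr_gt0.
by apply: le_esum => x _; rewrite mulKf ?gt_eqF.
Qed.

(** The integral of a nonnegative function is the supremum of the integrals of
    the simple functions below it, hence monotone without any regularity. *)
Lemma le_integral_nonneg d (T : measurableType d) (R : realType)
    (mu : {measure set T -> \bar R}) (D : set T) (f g : T -> \bar R) :
  (forall x, D x -> 0 <= f x)%E -> (forall x, D x -> f x <= g x)%E ->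
  (\int[mu]_(x in D) f x <= \int[mu]_(x in D) g x)%E.
Proof.
move=> f0 fg; have g0 x : D x -> (0 <= g x)%E by move=> Dx; rewrite (le_trans (f0 _ Dx)) ?fg.
rewrite !ge0_integralE//; apply: ereal_sup_le => _ [s sf <-]; exists s => // x.
by apply: le_trans (sf x) _; apply: lee_restrict.
Qed.

Lemma l2normsq_real (R : realType) (d : nat) (h : R) (omega : set 'rV[R]_d)
    (f : 'rV[R]_d -> R) :
  l2normsq h omega (fun x => (f x)%:C%C) =
  (\esum_(x in omega `&` grid h) (f x ^+ 2)%:E)%E.
Proof.
apply: eq_esum => x _; congr (_%:E).
by rewrite /Normc.normc /= expr0n/= addr0 sqrtr_sqr real_normK ?num_real.
Qed.

(** * The solution with final datum the peak *)

Section BackwardFlow.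
Context {R : realType} {d : nat}.
Variables (h m T : R) (V : 'rV[R]_d -> R) (c : 'rV[R]_d).
Hypothesis h_gt0 : 0 < h.
Hypothesis h_small : 2 * h ^+ 2 <= 1.
Hypothesis V_le : forall x, `|V x| <= m.

Local Notation phi := (peak c).
(* Lap_h - V = Q - q, where Q is the hopping operator with potential m - V;
   al and be are the bounds for Q phi / phi. *)
Let W x := m - V x.
Let al := 2 * d%:R / h ^+ 2 - 4 * d%:R.
Let be := 2 * d%:R / h ^+ 2 + 4 * d%:R + 2 * m.
Let q := 2 * d%:R / h ^+ 2 + m.

(** exp(s (Lap_h - V)) phi, the solution as a function of the time s = T - t
    elapsed since the final time. *)
Definition flow (s : R) (x : 'rV[R]_d) : R :=
  expR (- q * s) * hop_exp h W phi s x.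

Let m_ge0 : 0 <= m. Proof. exact: le_trans (normr_ge0 _) (V_le 0). Qed.

Let W_ge0 x : 0 <= W x.
Proof. by have := V_le x; rewrite ler_norml /W; lra. Qed.

Let phi_ge0 x : 0 <= phi x. Proof. by rewrite ltW ?peak_gt0. Qed.

Let hh_gt0 : 0 < h ^- 2. Proof. by rewrite invr_gt0 exprn_gt0. Qed.

Let al_ge0 : 0 <= al.
Proof.
have : 2 <= h ^- 2 by rewrite -[leRHS]mul1r ler_pdivlMr// exprn_gt0.
rewrite /al => h2; have d0 : 0 <= d%:R :> R by [].
by nra.
Qed.

Let be_ge0 : 0 <= be.
Proof.
have d0 : 0 <= d%:R :> R by [].
by rewrite /be; have := hh_gt0; have := m_ge0; nra.
Qed.

Let q_ge0 : 0 <= q.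
Proof.
have d0 : 0 <= d%:R :> R by [].
by rewrite /q; have := hh_gt0; have := m_ge0; nra.
Qed.

Let hop_phi x : al * phi x <= hop h W phi x <= be * phi x.
Proof.
have := peak_lap c x h; rewrite /hop; set S := \sum_(j < d) _.
have p0 := phi_ge0 x; have := V_le x.
rewrite !ler_norml /W /al /be => /andP[V1 V2] /andP[S1 S2].
have hE : h ^+ 2 * h ^- 2 = 1 by rewrite divff// expf_neq0// gt_eqF.
have {}S1 : h ^- 2 * S >= (2 * d%:R * h ^- 2 - 4 * d%:R) * phi x.
  have -> : (2 * d%:R * h ^- 2 - 4 * d%:R) * phi x =
    h ^- 2 * (2 * d%:R * phi x - 4 * d%:R * h ^+ 2 * phi x).
    transitivity ((2 * d%:R * h ^- 2 - 4 * d%:R * (h ^+ 2 * h ^- 2)) * phi x); last by ring.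
    by rewrite hE; ring.
  by rewrite ler_pM2l//; lra.
have {}S2 : h ^- 2 * S <= (2 * d%:R * h ^- 2 + 4 * d%:R) * phi x.
  have -> : (2 * d%:R * h ^- 2 + 4 * d%:R) * phi x =
    h ^- 2 * (2 * d%:R * phi x + 4 * d%:R * h ^+ 2 * phi x).
    transitivity ((2 * d%:R * h ^- 2 + 4 * d%:R * (h ^+ 2 * h ^- 2)) * phi x); last by ring.
    by rewrite hE; ring.
  by rewrite ler_pM2l//; lra.
have W1 : 0 <= (m - V x) * phi x by rewrite mulr_ge0//; lra.
have W2 : (m - V x) * phi x <= 2 * m * phi x by rewrite ler_wpM2r//; lra.
by apply/andP; split; lra.
Qed.

Let dom1 := dominated_phi phi_ge0.

(** The terms 2d/h^2 in al and be cancel against q: the rates that remain do not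
    depend on the mesh. *)
Lemma flow_bounds s x : 0 <= s ->
  expR (- ((m + 4 * d%:R) * s)) * phi x <= flow s x <=
  expR ((m + 4 * d%:R) * s) * phi x.
Proof.
move=> s0; rewrite /flow; apply/andP; split.
  have -> : - ((m + 4 * d%:R) * s) = - q * s + al * s by rewrite /q /al; ring.
  rewrite expRD -mulrA ler_pM2l ?expR_gt0//.
  exact: (hop_exp_ge W_ge0 phi_ge0 al_ge0 be_ge0 hop_phi).
have -> : (m + 4 * d%:R) * s = - q * s + be * s by rewrite /q /be; ring.
rewrite expRD -mulrA ler_pM2l ?expR_gt0//.
have := hop_exp_le W_ge0 be_ge0 hop_phi s x dom1.
by rewrite mul1r (ger0_norm s0); apply: le_trans; exact: ler_norm.
Qed.

Let flow_dom S s : `|s| <= S -> dominated phi (expR ((q + be) * S)) (flow s).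
Proof.
move=> sS; split=> [|x]; first exact: expR_ge0.
rewrite normrM gtr0_norm ?expR_gt0//.
have := hop_exp_le W_ge0 be_ge0 hop_phi s x dom1.
rewrite mul1r => A; rewrite [(q + be) * S]mulrDl expRD -mulrA; apply: ler_pM => //.
  rewrite ler_expR (le_trans (ler_norm _))// normrM normrN (ger0_norm q_ge0).
  by rewrite ler_wpM2l.
apply: le_trans A _; rewrite ler_wpM2r// ler_expR.
by rewrite ler_wpM2l.
Qed.

Lemma flow_derive (s : R) (x : 'rV[R]_d) :
  is_derive s 1 (fun s : R => flow s x) (hop h W (flow s) x - q * flow s x).
Proof.
have E := is_derive_hop_exp W_ge0 be_ge0 hop_phi s x dom1.
have X : is_derive s 1 (fun s => expR (- q * s)) (- q * expR (- q * s)).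
  have D : is_derive s 1 (fun s : R => - q * s) (- q).
    by apply: is_derive_eq; rewrite -[_ *: _]/(_ * _) mulr1.
  apply: is_derive_eq (is_derive1_comp (is_derive_expR _) D) _.
  by rewrite mulrC.
apply: is_derive_eq (is_deriveM X E) _.
rewrite /flow hop_scale -![_ *: _]/(_ * _); ring.
Qed.

Lemma flow_continuous (x : 'rV[R]_d) : continuous (fun s : R => flow s x).
Proof.
move=> s; apply: differentiable_continuous; apply/derivable1_diffP.
by have [] := flow_derive s x.
Qed.

(** The time derivative is dominated by phi, uniformly on bounded times; this
    gives continuity in l^2. *)
Lemma flow_lipschitz (S s t : R) x : `|s| <= S -> `|t| <= S ->
  `|flow s x - flow t x| <= (be + q) * expR ((q + be) * S) * `|s - t| * phi x.
Proof.
wlog st : s t / t <= s => [H sS tS|sS tS].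
  have [ts|/ltW st] := leP t s; first exact: H.
  by rewrite (distrC (flow s x)) (distrC s); exact: H.
have [r r_in ->] := MVT_segment st (fun r _ => flow_derive r x)
  (continuous_subspaceT (@flow_continuous x)).
rewrite normrM [leRHS]mulrAC ler_wpM2r//.
have rS : `|r| <= S.
  move: r_in sS tS; rewrite in_itv/= !ler_norml => /andP[? ?] /andP[? ?] /andP[? ?].
  by lra.
have D := flow_dom rS; have [_ /(_ x) A] := D.
have [_ /(_ x) B] := dominated_hop W_ge0 be_ge0 hop_phi D.
apply: le_trans (ler_normB _ _) _; rewrite normrM (ger0_norm q_ge0).
have -> (e : R) : (be + q) * e * phi x = e * be * phi x + q * (e * phi x) by ring.
by rewrite lerD// ler_wpM2l.
Qed.

Definition flow_sol (t : R) (x : 'rV[R]_d) : R[i] := (flow (T - t) x)%:C%C.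

Hypothesis h_le1 : h <= 1.

Lemma grid_sum_peak_sq_fin : (\esum_(x in grid h) (phi x ^+ 2)%:E < +oo)%E.
Proof.
apply: (@le_lt_trans _ _ ((8 / h) ^+ d)%:E); last exact: ltry.
apply: le_trans (grid_sum_peak_le c _); last by rewrite h_gt0.
by apply: le_esum => x _; rewrite lee_fin expr2 ler_piMl// peak_le1.
Qed.

Let sq_dom (K : R) (f : 'rV[R]_d -> R) (omega : set 'rV[R]_d) : 0 <= K ->
  (forall x, `|f x| <= K * phi x) ->
  (\esum_(x in omega `&` grid h) (f x ^+ 2)%:E
   <= (K ^+ 2)%:E * \esum_(x in omega `&` grid h) (phi x ^+ 2)%:E)%E.
Proof.
move=> K0 fK; rewrite -esumZ ?exprn_ge0//; apply: le_esum => x _.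
rewrite lee_fin -exprMn -[f x ^+ 2]real_normK ?num_real//.
by rewrite lerXn2r ?nnegrE// mulr_ge0.
Qed.

Lemma flow_in_l2 t : in_l2 h (flow_sol t).
Proof.
rewrite /in_l2 l2normsq_real.
have [_ D] := flow_dom (lexx `|T - t|).
apply: le_lt_trans (sq_dom _ (expR_ge0 _) D) _; rewrite setTI.
by rewrite lte_mul_pinfty ?grid_sum_peak_sq_fin// lee_fin sqr_ge0.
Qed.

(** The squared distance is at most (K |s - t|)^2 times the sum of phi^2. *)
Lemma flow_cvg t :
  l2normsq h setT (fun x => flow_sol s x - flow_sol t x)
    @[s --> within [set s | 0 <= s] (nbhs t)] --> 0%E.
Proof.
pose S : R := `|T - t| + 1; pose K := (be + q + 1) * expR ((q + be) * S).
have K0 : 0 < K by rewrite mulr_gt0 ?expR_gt0//; have := be_ge0; have := q_ge0; lra.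
pose N := fine (\esum_(x in grid h) (phi x ^+ 2)%:E)%E.
have NE : (\esum_(x in grid h) (phi x ^+ 2)%:E = N%:E)%E.
  rewrite fineK// ge0_fin_numE ?grid_sum_peak_sq_fin//.
  by apply: esum_ge0 => x _; rewrite lee_fin sqr_ge0.
suff L : l2normsq h setT (fun x => flow_sol s x - flow_sol t x) @[s --> t] --> 0%E.
  exact: cvg_within_filter.
apply: (squeeze_cvge (f := cst 0%E) (h := fun s => ((K * `|s - t|) ^+ 2 * N)%:E)).
- near=> s; apply/andP; split.
    by apply: esum_ge0 => x _; rewrite lee_fin sqr_ge0.
  have st : `|s - t| < 1.
    by near: s; exists 1 => //= s; rewrite /ball_/= distrC.
  have sS : `|T - s| <= S.
    rewrite /S (_ : T - s = (T - t) - (s - t)); last by ring.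
    by rewrite (le_trans (ler_normB _ _))// lerD2l ltW.
  have tS : `|T - t| <= S by rewrite /S lerDl.
  have -> : (fun x => flow_sol s x - flow_sol t x) =
      (fun x => (flow (T - s) x - flow (T - t) x)%:C%C).
    by apply/funext => x; rewrite /flow_sol -rmorphB.
  rewrite l2normsq_real setTI EFinM -NE.
  have D x : `|flow (T - s) x - flow (T - t) x| <= K * `|s - t| * phi x.
    apply: le_trans (flow_lipschitz x sS tS) _.
    rewrite (_ : T - s - (T - t) = t - s); last by ring.
    rewrite (distrC t) /K !ler_wpM2r ?expR_ge0//.
    by rewrite lerDl.
  have Kst : 0 <= K * `|s - t| by rewrite mulr_ge0// ltW.
  by have := sq_dom setT Kst D; rewrite setTI.
- exact: cvg_cst.
- apply/fine_cvgP; split; first by apply: nearW.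
  have st0 : `|s - t| @[s --> t] --> 0.
    rewrite -(normr0 R) -(subrr t); apply: cvg_norm.
    by apply: cvgB; [exact: cvg_id|exact: cvg_cst].
  have Kst0 : K * `|s - t| @[s --> t] --> 0.
    by rewrite -(mulr0 K); exact: cvgMl_tmp.
  have := cvgMr_tmp (b := N) (cvgM Kst0 Kst0); rewrite mulr0 mul0r.
  exact.
Unshelve. all: by end_near.
Qed.

Lemma flow_sol_derive t x :
  is_cderive (fun s => flow_sol s x) t
    (- discrete_laplacian h (flow_sol t) x + (V x)%:C%C * flow_sol t x).
Proof.
pose v := flow (T - t); pose D := hop h W v x - q * v x.
have -> : - discrete_laplacian h (flow_sol t) x + (V x)%:C%C * flow_sol t x =
    (- D)%:C%C.
  rewrite /discrete_laplacian /flow_sol -/v.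
  have -> : (\sum_(j < d) ((v (x + h *: basis_vec R j))%:C%C +
      (v (x - h *: basis_vec R j))%:C%C - 2 * (v x)%:C%C)) =
      (\sum_(j < d) (v (x + h *: basis_vec R j) + v (x - h *: basis_vec R j)
         - 2 * v x))%:C%C.
    rewrite rmorph_sum/=; apply: eq_bigr => j _.
    move: (v x) (v (x + _)) (v (x - _)) => a b e.
    by rewrite rmorphB rmorphD rmorphM rmorph_nat.
  rewrite -!rmorphM/= -rmorphN -rmorphD/=; congr (_%:C%C).
  rewrite sumrB sumr_const card_ord /D /hop /W /q -mulr_natr.
  by rewrite -/(h ^- 2); ring.
split; last exact: is_derive_cst.
have shift : is_derive t 1 (fun s : R => T - s) (- 1).
  apply: is_derive_eq (is_deriveB (is_derive_cst T t 1) (is_derive_id t 1)) _.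
  by rewrite sub0r.
have := @is_derive1_comp R _ (fun s => T - s) t _ _ (flow_derive (T - t) x) shift.
by rewrite mulrN1.
Qed.

Lemma flow_sol_is_solution : is_solution h V T (flow_sol T) flow_sol.
Proof.
split=> [t _|t _|t x _ _|//].
- exact: flow_in_l2.
- exact: flow_cvg.
- exact: flow_sol_derive.
Qed.

End BackwardFlow.

(** * Consequences of observability *)

Section Observability.
Context {R : realType} {d : nat}.
Implicit Types (h m T C : R) (V : 'rV[R]_d -> R) (c : 'rV[R]_d).

(** By [flow_bounds], u(0) >= a phi and u(t) <= phi / a.  Since exp(y) >= y, the
    factor C exp(-C/h^2) is at most h^2, and the smallness of h lets the last
    term of the observability inequality be absorbed in the left-hand side. *)
Lemma observed_mass h m T C V c (omega : set 'rV[R]_d) :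
  let a := expR (- ((m + 4 * d%:R) * T)) in
  0 < h <= 1 -> 2 * h ^+ 2 <= a ^+ 2 -> 0 < T -> 0 < C ->
  (forall x, `|V x| <= m) ->
  observable h omega T C (flow_sol h m T V c) ->
  ((a ^+ 4)%:E * (\esum_(x in grid h) (peak c x ^+ 2)%:E)
   <= (2 * C * T)%:E * \esum_(x in omega `&` grid h) (peak c x ^+ 2)%:E)%E.
Proof.
move=> a /andP[h0 h1] ha T0 C0 Vm.
have m0 : 0 <= m := le_trans (normr_ge0 _) (Vm 0).
have d0 : 0 <= d%:R :> R by [].
have a0 : 0 < a by exact: expR_gt0.
have a1 : a <= 1 by rewrite -expR0 ler_expR; nra.
have h2 : 2 * h ^+ 2 <= 1 by nra.
have bounds := flow_bounds c h0 h2 Vm.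
have p0 x : 0 <= peak c x by rewrite ltW ?peak_gt0.
rewrite /observable !l2normsq_real !subr0 subrr setTI.
set E0 := (\esum_(_ in grid h) (flow _ _ _ _ T _ ^+ 2)%:E)%E.
set ET := (\esum_(_ in grid h) _)%E.
set N := (\esum_(_ in grid h) (peak _ _ ^+ 2)%:E)%E.
set I := (\int[_]_(_ in _) _)%E.
set E := (\esum_(_ in omega `&` _) _)%E.
have N0 : (0 <= N)%E by apply: esum_ge0 => x _; rewrite lee_fin sqr_ge0.
have Nfin : N \is a fin_num by rewrite ge0_fin_numE// grid_sum_peak_sq_fin.
have Ege0 : (0 <= E)%E by apply: esum_ge0 => x _; rewrite lee_fin sqr_ge0.
have EN : (E <= N)%E by exact: esum_subset.
have Efin : E \is a fin_num.
  by rewrite ge0_fin_numE// (le_lt_trans EN)// -ge0_fin_numE.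
have E0_ge : ((a ^+ 2)%:E * N <= E0)%E.
  rewrite -esumZ ?sqr_ge0//; apply: le_esum => x _; rewrite lee_fin -exprMn.
  have /andP[lo _] := bounds T x (ltW T0).
  have ap0 : 0 <= a * peak c x by rewrite mulr_ge0// ltW.
  by apply: lerXn2r; rewrite ?nnegrE// (le_trans ap0).
have ET_le : (ET <= N)%E.
  apply: le_esum => x _; rewrite lee_fin.
  have := bounds 0 x (lexx _); rewrite mulr0 oppr0 expR0 !mul1r => /andP[lo hi].
  by apply: lerXn2r; rewrite ?nnegrE// (le_trans _ lo).
have I_le : (I <= (a ^- 2 * T)%:E * E)%E.
  apply: (@le_trans _ _ (\int[lebesgue_measure]_(t in `[0%R, T]) cst ((a ^- 2)%:E * E)%E t)%E).
    apply: le_integral_nonneg => t /=; rewrite in_itv/= => /andP[t0 tT].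
      by apply: esum_ge0 => x _; rewrite lee_fin sqr_ge0.
    rewrite l2normsq_real -esumZ ?invr_ge0 ?sqr_ge0//; apply: le_esum => x _.
    rewrite lee_fin -exprVn -exprMn.
    have Tt : 0 <= T - t by rewrite subr_ge0.
    have /andP[lo hi] := bounds (T - t) x Tt.
    have lo0 : 0 <= flow h m V c (T - t) x.
      by apply: le_trans lo; rewrite mulr_ge0 ?expR_ge0.
    have ap0 : 0 <= a^-1 * peak c x by rewrite mulr_ge0 ?invr_ge0 ?(ltW a0).
    apply: lerXn2r; rewrite ?nnegrE//.
    apply: le_trans hi _; rewrite ler_wpM2r// /a expRN invrK ler_expR.
    by rewrite ler_wpM2l//; nra.
  rewrite integral_cst//= lebesgue_measure_itv/= lte_fin T0 sube0 EFinM.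
  by rewrite muleAC.
have expC : C * expR (- C / h ^+ 2) <= h ^+ 2.
  have hh : 0 < h ^+ 2 by rewrite exprn_gt0.
  rewrite mulNr expRN ler_pdivrMr ?expR_gt0//.
  rewrite -ler_pdivrMl// [leLHS]mulrC (le_trans _ (expR_ge1Dx _))//.
  by rewrite lerDr.
move=> obs.
have := le_trans E0_ge obs.
move: E0_ge obs; rewrite -(fineK Nfin) -(fineK Efin) in ET_le I_le N0 Ege0 *.
set n := fine N in ET_le I_le N0 *; set e := fine E in I_le Ege0 *.
move=> _ _ H.
have {}H : ((a ^+ 2 * n)%:E <= (C * (a ^- 2 * T * e) + h ^+ 2 * n)%:E)%E.
  rewrite EFinM; apply: (le_trans H); rewrite EFinD; apply: leeD.
    by rewrite EFinM lee_pmul2l// EFinM.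
  apply: (@le_trans _ _ ((h ^+ 2)%:E * ET)%E).
    rewrite lee_wpmul2r//.
    by apply: esum_ge0 => x _; rewrite lee_fin sqr_ge0.
  by rewrite [leRHS]EFinM lee_wpmul2l// lee_fin sqr_ge0.
rewrite -!EFinM lee_fin; rewrite !lee_fin in H N0 Ege0.
have {}H : a ^+ 2 * n <= 2 * C * T * e * a ^- 2.
  have : h ^+ 2 * n <= a ^+ 2 / 2 * n by rewrite ler_wpM2r//; lra.
  by lra.
have a2 : 0 < a ^+ 2 by rewrite exprn_gt0.
have -> : a ^+ 4 * n = a ^+ 2 * n * a ^+ 2 by ring.
by rewrite -ler_pdivlMr.
Qed.

End Observability.

Lemma esum_setU_le (R : realType) (T : choiceType) (A B : set T) (a : T -> \bar R) :
  (forall x, 0 <= a x)%E ->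
  (\esum_(x in A `|` B) a x <= \esum_(x in A) a x + \esum_(x in B) a x)%E.
Proof.
move=> a0; rewrite (esumID A)//; apply: leeD; apply: esum_subset => x /=; tauto.
Qed.

(** Outside the cube of side L one factor of phi is at most 1 / (1 + L^2/4), so
    phi^2 <= phi / (1 + L^2/4) there, and the sum of phi is at most
    (8/h)^d; inside, phi^2 <= 1 turns the sum into a count. *)
Lemma observable_density (R : realType) (d : nat) (omega : set 'rV[R]_d)
    (V : 'rV[R]_d -> R) (T h0 C : R) :
  bounded_fun V -> 0 < T -> 0 < h0 -> 0 < C ->
  (forall h : R, 0 < h <= h0 -> forall uF : 'rV[R]_d -> R[i], in_l2 h uF ->
    forall u : R -> 'rV[R]_d -> R[i], is_solution h V T uF u ->
    observable h omega T C u) ->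
  exists L gamma h1 : R, [/\ 0 < L, 0 < gamma, 0 < h1 &
    forall (h : R) (c : 'rV[R]_d), 0 < h <= h1 ->
    ((gamma / h ^+ d)%:E <= \esum_(x in (omega `&` cube c L) `&` grid h) 1)%E].
Proof.
move=> Vb T0 h00 C0 obs.
have [m Vm] : exists m, forall x, `|V x| <= m.
  have [M [_ MP]] := Vb; exists (M + 1) => x.
  by apply: (MP (M + 1)) => //; rewrite ltrDl.
pose a := expR (- ((m + 4 * d%:R) * T)); have a0 : 0 < a := expR_gt0 _.
pose k := a ^+ 4 / (2 * C * T).
have CT0 : 0 < 2 * C * T by rewrite !mulr_gt0.
have k0 : 0 < k by rewrite divr_gt0// exprn_gt0.
(* L is such that the tail, at most (8/h)^d / M, is half of the lower bound
   k (4h)^-d for the mass seen by omega. *)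
pose M := 2 * 32 ^+ d / k.
have M0 : 0 < M by rewrite divr_gt0// mulr_gt0// exprn_gt0.
pose L := 2 * (M + 1); pose gamma := k / 4 ^+ d / 2.
pose h1 := Num.min h0 (Num.min 1 (a / 2)).
exists L, gamma, h1; split.
- by rewrite /L; lra.
- by rewrite /gamma !divr_gt0// exprn_gt0.
- by rewrite /h1 !lt_min h00 ltr01 divr_gt0.
move=> h c /andP[hp]; rewrite /h1 !le_min => /and3P[hh0 hle1 ha].
have h01 : 0 < h <= 1 by rewrite hp.
have h2a : 2 * h ^+ 2 <= a ^+ 2 by nra.
have m0 : 0 <= m := le_trans (normr_ge0 _) (Vm 0).
have a1 : a <= 1.
  by rewrite -expR0 ler_expR; have d0 : 0 <= d%:R :> R by []; nra.
have p0 x : 0 <= peak c x by rewrite ltW ?peak_gt0.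
have h0h : 0 < h <= h0 by rewrite hp.
have := observed_mass h01 h2a T0 C0 Vm (obs h h0h _ (flow_in_l2 T c hp Vm hle1 T) _
  (flow_sol_is_solution T c hp Vm hle1)).
rewrite -/a; have a4 : (0 <= (a ^+ 4)%:E)%E by rewrite lee_fin exprn_ge0// ltW.
move=> /(le_trans (lee_wpmul2l a4 (grid_sum_peak_sq_ge c h01))) mass.
pose t := (1 + (L / 2) ^+ 2)^-1.
have tail : (\esum_(x in ~` cube c L `&` grid h) (peak c x ^+ 2)%:E <=
    (t * (8 / h) ^+ d)%:E)%E.
  have t0 : 0 <= t by rewrite invr_ge0 addr_ge0// sqr_ge0.
  apply: (@le_trans _ _ (t%:E * (\esum_(x in grid h) (peak c x)%:E))%E); last first.
    by rewrite EFinM lee_wpmul2l ?lee_fin// grid_sum_peak_le.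
  rewrite -esumZ//; apply: (@le_trans _ _
    (\esum_(x in ~` cube c L `&` grid h) (t * peak c x)%:E)%E).
    apply: le_esum => x [/= /existsNP[j]].
    rewrite -ler_distl => /negP; rewrite -ltNge => xj _.
    rewrite lee_fin expr2 ler_wpM2r// [leLHS](bigD1 j)//= -[leRHS]mulr1 ler_pM//.
    - by rewrite ltW ?profile_gt0.
    - by apply: prodr_ge0 => i _; rewrite ltW ?profile_gt0.
    - rewrite lef_pV2 ?posrE ?profile_den_gt0// lerD2l -[leRHS]real_normK ?num_real//.
      by apply: lerXn2r; rewrite ?nnegrE ?(ltW xj)//; rewrite /L; lra.
    - by apply: prodr_ile1 => i _; rewrite ltW ?profile_gt0// profile_le1.
  by apply: esum_subset => x [].
have split_le : (\esum_(x in omega `&` grid h) (peak c x ^+ 2)%:E <=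
    \esum_(x in (omega `&` cube c L) `&` grid h) 1 + (t * (8 / h) ^+ d)%:E)%E.
  apply: le_trans (leeD (lexx _) tail).
  apply: (@le_trans _ _ (\esum_(x in (omega `&` cube c L) `&` grid h) (peak c x ^+ 2)%:E +
     \esum_(x in ~` cube c L `&` grid h) (peak c x ^+ 2)%:E)%E).
    rewrite (le_trans _ (esum_setU_le _ _ _))//; last by move=> x; rewrite lee_fin sqr_ge0.
    apply: esum_subset => x [ox gx]; have [xc|xc] := pselect (cube c L x); [left|right]; by [].
  rewrite leeD2r//; apply: le_esum => x _.
  by rewrite lee_fin exprn_ile1// peak_le1.
move: split_le; case: (\esum_(x in _ `&` cube c L `&` _) 1)%E => [x| |];
  [|by move=> _; exact: leey|]; last first.
  rewrite addNye leeNy_eq => /eqP absd; move: mass; rewrite absd.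
  by rewrite mulrNy gtr0_sg// mul1e leeNy_eq.
move=> split_le; have {mass split_le} :=
  le_trans mass (lee_wpmul2l (_ : 0 <= (2 * C * T)%:E)%E split_le).
rewrite !lee_fin => /(_ (ltW CT0)) main.
have hd0 : 0 < h ^+ d by rewrite exprn_gt0.
have {}main : k * (4 * h)^-1 ^+ d <= x + t * (8 / h) ^+ d.
  by rewrite /k mulrAC ler_pdivrMr// [leRHS]mulrC.
have tM : t <= M^-1.
  rewrite lef_pV2 ?posrE// ?ltr_pwDl ?sqr_ge0// /L; nra.
have e1 : k * (4 * h)^-1 ^+ d = 2 * (gamma / h ^+ d).
  rewrite /gamma exprVn exprMn; field; rewrite !expf_neq0 ?gt_eqF//.
have e2 : M^-1 * (8 / h) ^+ d = gamma / h ^+ d.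
  rewrite /gamma /M (_ : 32 = 4 * 8 :> R); last by ring.
  rewrite expr_div_n !exprMn; field; rewrite !expf_neq0 ?gt_eqF//.
have : t * (8 / h) ^+ d <= M^-1 * (8 / h) ^+ d.
  by rewrite ler_wpM2r// exprn_ge0// divr_ge0// ltW.
by lra.
Qed.

(** * Asymptotic density of grid points *)

Section Density.
Context {R : realType} {d : nat}.
Implicit Types (A B O : set 'rV[R]_d) (s t : R).

(** The volume of A as seen by the grids, bounded from above; unlike the volume
    itself, it is only finitely subadditive. *)
Definition density_le A s := exists2 e : R, 0 < e &
  forall h, 0 < h < e -> (\esum_(x in A `&` grid h) 1 <= (s / h ^+ d)%:E)%E.

Lemma density_leS A B s t : A `<=` B -> s <= t -> density_le B s -> density_le A t.
Proof.
move=> AB st [e e0 Be]; exists e => // h he.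
apply: (@le_trans _ _ (\esum_(x in B `&` grid h) 1)%E).
  by apply: esum_subset => x [/AB].
apply: (le_trans (Be h he)); rewrite lee_fin ler_wpM2r// invr_ge0 exprn_ge0//.
by case/andP: he => /ltW.
Qed.

Lemma density_le0 : density_le set0 0.
Proof. by exists 1 => // h _; rewrite set0I esum_set0 mul0r. Qed.

Lemma density_leU A B s t : density_le A s -> density_le B t ->
  density_le (A `|` B) (s + t).
Proof.
move=> [e e0 Ae] [f f0 Bf]; exists (Num.min e f); first by rewrite lt_min e0.
move=> h /andP[h0]; rewrite lt_min => /andP[he hf].
rewrite setIUl (le_trans (esum_setU_le _ _ _))//.
by rewrite mulrDl EFinD leeD ?Ae ?Bf ?h0.
Qed.

Lemma density_le_bigcup (F : nat -> set 'rV[R]_d) (s : nat -> R) N :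
  (forall n, density_le (F n) (s n)) ->
  density_le (\bigcup_(n in `I_N) F n) (\sum_(n < N) s n).
Proof.
move=> Fs; elim: N => [|N ih].
  by rewrite II0 bigcup_set0 big_ord0; exact: density_le0.
by rewrite IIS bigcup_setU bigcup_set1 big_ord_recr; exact: density_leU.
Qed.

(** [grid_count_le] bounds h^d times the count by the product of the l_i + h,
    which tends to the product of the l_i. *)
Lemma density_le_widths A (j : 'I_d) (l : 'I_d -> R) s :
  (forall i, 0 <= l i) ->
  (forall x y, A x -> A y -> forall i, i != j -> `|x 0 i - y 0 i| <= l i) ->
  (forall x y, A x -> A y -> (forall i, i != j -> x 0 i = y 0 i) ->
     `|x 0 j - y 0 j| <= l j) ->
  \prod_i l i < s -> density_le A s.
Proof.
move=> l0 Al Alj ls.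
have : \forall h \near (0 : R), \prod_i (l i + h) < s.
  have : \prod_i (l i + h) @[h --> (0 : R)] --> \prod_i (l i + 0).
    apply: cvg_big; first exact: mul_continuous.
    by move=> i _; apply: cvgD; [exact: cvg_cst | exact: cvg_id].
  under [in X in _ --> X]eq_bigr do rewrite addr0.
  by move/cvgr_lt; apply.
move=> [e /= e0 es]; exists e => // h /andP[h0 he].
apply: (le_trans (grid_count_le h0 l0 Al Alj)).
have : \prod_i (l i + h) < s by apply: es; rewrite /= sub0r normrN gtr0_norm.
rewrite lee_fin ler_pdivlMr ?exprn_gt0// => /ltW; apply: le_trans.
rewrite -[X in _ ^+ X](card_ord d) -prodr_const -big_split/=.
rewrite le_eqVlt; apply/orP; left; apply/eqP; apply: eq_bigr => i _.
by field; rewrite gt_eqF.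
Qed.

End Density.

(** The Heine-Borel property in the form of an induction principle. *)
Lemma compact_set_induction (T : ptopologicalType) (K : set T) (Q : set T -> Prop) :
  compact K -> Q set0 -> (forall A B, A `<=` B -> Q B -> Q A) ->
  (forall A B, Q A -> Q B -> Q (A `|` B)) ->
  (forall p, K p -> exists U, [/\ open U, U p & Q (U `&` K)]) -> Q K.
Proof.
move=> Kc Q0 Qsub QU Qloc.
have [f fP] : exists f : T -> set T, forall p, K p -> [/\ open (f p), f p p & Q (f p `&` K)].
  have : forall p, exists U, K p -> [/\ open U, U p & Q (U `&` K)].
    move=> p; have [/Qloc[U UP]|nKp] := pselect (K p); first by exists U.
    by exists set0 => /nKp.
  by move=> /choice[f fP]; exists f.
move: Kc; rewrite compact_cover => /(_ T K f)[p /fP[]//|p Kp|D DK KD].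
  by exists p => //; have [] := fP p Kp.
suff : Q (\bigcup_(p in [set` D]) (f p `&` K)).
  by apply: Qsub => x Kx; have [p Dp fpx] := KD x Kx; exists p.
rewrite bigcup_fset big_seq; apply: (big_ind Q) => // p /DK; rewrite inE => Kp.
by have [] := fP p Kp.
Qed.

(** * Smooth boundaries are thin *)

Section Boundary.
Context {R : realType} {d : nat}.
Implicit Types (omega U : set 'rV[R]_d) (f : 'rV[R]_d -> R).

(** The open neighbourhoods are needed to remove the boundary from a compact set
    and keep the rest compact. *)
Definition thin (A : set 'rV[R]_d) := forall e : R, 0 < e ->
  exists O : set 'rV[R]_d, [/\ open O, A `<=` O & density_le O e].

Lemma thin0 : thin set0.
Proof.
move=> e e0; exists set0; split=> //.
by apply: density_leS density_le0 => //; exact: ltW.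
Qed.

Lemma thin_sub A B : A `<=` B -> thin B -> thin A.
Proof.
move=> AB Bt e e0; have [W [Wo BW We]] := Bt e e0; exists W; split=> //; exact: subset_trans BW.
Qed.

Lemma thinU A B : thin A -> thin B -> thin (A `|` B).
Proof.
move=> At Bt e e0; have e2 : 0 < e / 2 by rewrite divr_gt0.
have [W [Wo AW We]] := At _ e2; have [P [Po BP Pe]] := Bt _ e2.
exists (W `|` P); split; [exact: openU | exact: setUSS |].
by rewrite [e]splitr; exact: density_leU.
Qed.

Lemma line_is_derive f (x v : 'rV[R]_d) (t : R) :
  derivable f (x + t *: v) v ->
  is_derive t 1 (fun s : R => f (x + s *: v)) ('D_v f (x + t *: v)).
Proof.
have E : (fun s : R => s^-1 *: (((fun s => f (x + s *: v)) \o shift t) (s *: 1)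
            - f (x + t *: v))) =
    (fun s : R => s^-1 *: ((f \o shift (x + t *: v)) (s *: v) - f (x + t *: v))).
  apply/funext => s /=; congr (_ *: (f _ - _)).
  by rewrite -[s *: 1]/(s * 1) mulr1 scalerDl addrCA.
by move=> fv; split; rewrite /derivable /derive E.
Qed.

(** The mean value theorem on the segment from x to y.  Stated with
    absolute values, it covers both signs of the partial derivative. *)
Lemma line_expansion f (j : 'I_d) (k r : R) (p x y : 'rV[R]_d) :
  (forall z, ball p r z -> derivable f z (basis_vec R j) /\
     k <= `|'D_(basis_vec R j) f z|) ->
  ball p r x -> ball p r y -> (forall i, i != j -> x 0 i = y 0 i) ->
  k * `|x 0 j - y 0 j| <= `|f x - f y|.
Proof.
move=> fP.
wlog xy : x y / x 0 j <= y 0 j => [H px py E|].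
  have [xy|/ltW yx] := leP (x 0 j) (y 0 j); first exact: H.
  rewrite distrC (distrC (f x)); apply: H => // i ij; by rewrite E.
move=> px py E; set l := y 0 j - x 0 j.
have l0 : 0 <= l by rewrite subr_ge0.
have yE : y = x + l *: basis_vec R j.
  apply/rowP => i; rewrite !mxE eqxx/=; have [->|ij] := eqVneq i j.
    by rewrite mulr1 /l addrC subrK.
  by rewrite mulr0 addr0 E.
have seg t : 0 <= t <= l -> ball p r (x + t *: basis_vec R j).
  move=> /andP[t0 tl]; move: px py; rewrite /ball/= /mx_ball => -[r0 px] [_ py].
  split=> // i' i.
  have := px i' i; have := py i' i; rewrite (ord1 i') yE !mxE /ball/= /ball_/=.
  have [_|_] := eqVneq i j; last by rewrite !mulr0 !addr0.
  rewrite !mulr1 !ltr_norml => /andP[? ?] /andP[? ?]; apply/andP; split; lra.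
have D t : 0 <= t <= l -> is_derive t 1 (fun s : R => f (x + s *: basis_vec R j))
    ('D_(basis_vec R j) f (x + t *: basis_vec R j)).
  by move=> tl; apply: line_is_derive; have [] := fP _ (seg t tl).
have cont : {within `[0, l], continuous (fun s : R => f (x + s *: basis_vec R j))}.
  by apply: derivable_within_continuous => t; rewrite in_itv/= => /D dt; case: dt.
have Doo t : t \in `]0, l[%R -> is_derive t 1 (fun s : R => f (x + s *: basis_vec R j))
    ('D_(basis_vec R j) f (x + t *: basis_vec R j)).
  by move=> /subset_itv_oo_cc; rewrite in_itv/=; exact: D.
have [s] := MVT_segment l0 Doo cont; rewrite in_itv/= => s_in.
rewrite -yE scale0r addr0 subr0 => fE.
rewrite (distrC (f x)) fE normrM (distrC (x 0 j)) -/l ler_wpM2r//.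
by have [] := fP _ (seg s s_in).
Qed.

Lemma boundary_open_zero omega U f p : open omega -> open U ->
  (forall x, U x -> omega x <-> f x < 0) -> {for p, continuous f} -> U p ->
  boundary omega p -> f p = 0.
Proof.
move=> oo Uo E fc Up [clp nip]; apply/eqP; rewrite eq_le; apply/andP; split.
  rewrite leNgt; apply/negP => fp0.
  have : nbhs p (U `&` [set x | 0 < f x]).
    apply: filterI; first exact: open_nbhs_nbhs.
    exact: (cvgr_gt _ fc).
  move=> /clp[y [oy [Uy /= fy]]].
  by have := (E y Uy).1 oy; rewrite ltNge ltW.
rewrite leNgt; apply/negP => fp0; apply: nip; rewrite -/(interior omega p).
rewrite (_ : interior omega = omega); last exact/interior_id.
exact: (E p Up).2.
Qed.

(** In a ball of radius r around p where the j-th partial derivative of f is at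
    least k in absolute value, [line_expansion] shows that { |f| < eta } meets
    lines in direction j in pieces of length at most 2 eta / k, while the other
    widths are at most 2 r: the density is at most (2r)^(d-1) 2 eta / k, which
    is small with eta. *)
Lemma smooth_boundary_locally_thin omega p : open omega ->
  smooth_boundary omega -> boundary omega p ->
  exists U, [/\ open U, U p & thin (U `&` boundary omega)].
Proof.
move=> oo sb /sb[U [f [Uo Up fs [j fj] omegaE]]].
have E x : U x -> omega x <-> f x < 0.
  move=> Ux; split=> [ox|fx].
    by have : (omega `&` U) x by []; rewrite omegaE => -[].
  by have : ([set x | f x < 0] `&` U) x by []; rewrite -omegaE => -[].
clear omegaE.
have [fc /(_ j)[fd [dc _]]] := fs 1%N.
set D := fun x => 'D_(basis_vec R j) f x in dc.
pose k := `|D p| / 2; have k0 : 0 < k by rewrite divr_gt0// normr_gt0.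
have : nbhs p (U `&` [set x | k <= `|D x|]).
  apply: filterI; first exact: open_nbhs_nbhs.
  have : \forall x \near p, `|D p - D x| < k by move/cvgr_dist_lt: (dc p Up); apply.
  apply: filterS => x /= Dx; have := ler_distD 0 (D p) (D x).
  have := lerB_dist (D p) (D x); rewrite /k in Dx *; lra.
move=> /nbhs_ballP[r /= r0 rP].
exists (ball p r); split; [exact: ball_open|exact: ballxx|] => e e0.
pose M := \prod_(i < d | i != j) (2 * r).
have M0 : 0 < M by apply: prodr_gt0 => i _; rewrite mulr_gt0.
(* The factor 4 makes the product of the widths equal to e / 2. *)
pose eta := e * k / (4 * M); have eta0 : 0 < eta by apply: divr_gt0; apply: mulr_gt0.
exists (ball p r `&` [set x | `|f x| < eta]); split.
- rewrite openE => x [px /= fx]; apply: filterI.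
    by apply: open_nbhs_nbhs; split=> //; exact: ball_open.
  have [Ux _] := rP _ px.
  move/cvgr_dist_lt: (fc x Ux) => /(_ (eta - `|f x|)); rewrite subr_gt0 => /(_ fx).
  apply: filterS => y /= fxy; have := ler_normB (f x) (f x - f y).
  by rewrite opprB addrC subrK; lra.
- move=> x [px bx]; split=> //=; have [Ux _] := rP _ px.
  by rewrite (boundary_open_zero oo Uo E (fc x Ux) Ux bx) normr0.
pose l i := if i == j then 2 * eta / k else 2 * r.
apply: (@density_le_widths _ _ _ j l).
- move=> i; rewrite /l; case: ifP => _; apply: ltW; last exact: mulr_gt0.
  by apply: divr_gt0 => //; exact: mulr_gt0.
- move=> x y [px _] [py _] i ij; rewrite /l (negbTE ij).
  move: px py; rewrite /ball/= /mx_ball => -[_ /(_ 0 i)] px [_ /(_ 0 i)].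
  move: px; rewrite /ball/= /ball_/= !ltr_norml ler_norml.
  by move=> /andP[? ?] /andP[? ?]; apply/andP; split; lra.
- move=> x y [px /= fx] [py /= fy] xy; rewrite /l eqxx ler_pdivlMr// mulrC.
  have fP z : ball p r z -> derivable f z (basis_vec R j) /\
      k <= `|'D_(basis_vec R j) f z|.
    by move=> /rP[Uz kz]; split=> //; exact: fd.
  apply: le_trans (line_expansion fP px py xy) _.
  by apply: le_trans (ler_normB _ _) _; lra.
rewrite (bigD1 j)//= /l eqxx (eq_bigr (fun=> 2 * r)); last first.
  by move=> i /negbTE ->.
rewrite -/M (_ : 2 * eta / k * M = e / 2); first lra.
by rewrite /eta; field; rewrite !gt_eqF.
Qed.

End Boundary.

(** * From density to volume *)

Section Covering.
Context {R : realType} {d : nat}.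
Implicit Types (omega : set 'rV[R]_d).

Lemma cube_compact (c : 'rV[R]_d) (L : R) : compact (cube c L).
Proof.
have -> : cube c L = [set v | forall i, `[c 0 i - L / 2, c 0 i + L / 2]%classic (v ord0 i)].
  by apply/seteqP; split=> v vc i; have := vc i; rewrite /= in_itv.
apply: (@rV_compact R d (fun i => `[c 0 i - L / 2, c 0 i + L / 2]%classic)) => i.
exact: segment_compact.
Qed.

Lemma boundary_cube_thin omega (c : 'rV[R]_d) (L : R) : open omega ->
  smooth_boundary omega -> thin (boundary omega `&` cube c L).
Proof.
move=> oo sb.
apply: (@compact_set_induction 'rV[R]_d _ thin);
  [|exact: thin0|exact: thin_sub|exact: thinU|move=> p [bp _]].
  rewrite setIC; apply: compact_closedI; first exact: cube_compact.
  apply: closedI; first exact: closed_closure.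
  by apply: open_closedC; exact: open_interior.
have [U [Uo Up Ut]] := smooth_boundary_locally_thin oo sb bp.
exists U; split=> //; apply: thin_sub Ut => x [Ux [bx _]]; by [].
Qed.

Lemma enlarged_box (a b : 'rV[R]_d) (e : R) : (0 < d)%N ->
  (forall j, a 0 j <= b 0 j) -> 0 < e ->
  exists B : set 'rV[R]_d,
    [/\ open B, [set x : 'rV[R]_d | forall j, a 0 j <= x 0 j <= b 0 j] `<=` B &
        density_le B (\prod_(j < d) (b 0 j - a 0 j) + e)].
Proof.
move=> d0 ab e0.
have : \forall r \near (0 : R), \prod_(j < d) (b 0 j - a 0 j + 2 * r) <
    \prod_(j < d) (b 0 j - a 0 j) + e.
  have : \prod_(j < d) (b 0 j - a 0 j + 2 * r) @[r --> (0 : R)] -->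
      \prod_(j < d) (b 0 j - a 0 j + 2 * 0).
    apply: cvg_big; first exact: mul_continuous.
    move=> j _; apply: cvgD; [exact: cvg_cst | apply: cvgMl_tmp; exact: cvg_id].
  under [in X in _ --> X]eq_bigr do rewrite mulr0 addr0.
  by move/cvgr_lt; apply; rewrite ltrDl.
move=> [s /= s0 sP]; pose r := s / 2; have r0 : 0 < r by rewrite divr_gt0.
have {sP}rP : \prod_(j < d) (b 0 j - a 0 j + 2 * r) <
    \prod_(j < d) (b 0 j - a 0 j) + e.
  by apply: sP; rewrite /= sub0r normrN gtr0_norm// /r; lra.
exists [set x : 'rV[R]_d | forall j, a 0 j - r < x 0 j < b 0 j + r]; split.
- rewrite openE => x xB.
  apply: (@filter_forall _ _
    (fun (j : 'I_d) (y : 'rV[R]_d) => a 0 j - r < y 0 j < b 0 j + r) (nbhs x)) => j.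
  have /andP[xl xu] := xB j.
  have xc : (fun y : 'rV[R]_d => y 0 j) @ x --> x 0 j by exact: coord_continuous.
  near=> y; apply/andP; split; near: y.
    exact: (cvgr_gt _ xc).
  exact: (cvgr_lt _ xc).
- by move=> x xab j; have /andP[? ?] := xab j; apply/andP; split; lra.
apply: (@density_le_widths _ _ _ (Ordinal d0) (fun j => b 0 j - a 0 j + 2 * r)) => //.
- by move=> j; have := ab j; lra.
- move=> x y xB yB j _; have /andP[? ?] := xB j; have /andP[? ?] := yB j.
  by rewrite ler_norml; apply/andP; split; lra.
- move=> x y xB yB _; have /andP[? ?] := xB (Ordinal d0); have /andP[? ?] := yB (Ordinal d0).
  by rewrite ler_norml; apply/andP; split; lra.
Unshelve. all: by end_near. Qed.

(** Given a cover of omega and the cube by boxes, enlarge the n-th box to an open one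
    at the cost e / 2^(n+2), and take an open W of density e/2 around the boundary.
    W and the open boxes cover the compact intersection of the closure of omega
    with the cube, so W and finitely many boxes do. *)
Lemma density_le_lebesgue_vol omega (c : 'rV[R]_d) (L g : R) : (0 < d)%N ->
  open omega -> smooth_boundary omega ->
  (forall s, density_le (omega `&` cube c L) s -> g <= s) ->
  (g%:E <= lebesgue_vol (omega `&` cube c L))%E.
Proof.
move=> d0 oo sb gP; apply: le_ereal_inf_tmp => _ [a [b [ab cov ->]]].
set v := fun n => \prod_(j < d) (b n 0 j - a n 0 j).
have v0 n : (0 <= (v n)%:E)%E.
  by rewrite lee_fin; apply: prodr_ge0 => j _; rewrite subr_ge0.
have partial N : ((\sum_(n < N) v n)%:E <= \sum_(0 <= n <oo) (v n)%:E)%E.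
  by rewrite -sumEFin -(big_mkord predT (fun n => (v n)%:E)); exact: nneseries_lim_ge.
move: partial; case: (\sum_(0 <= n <oo) (v n)%:E)%E => [s| |] partial; last first.
- by have := partial 0%N; rewrite leeNy_eq.
- exact: leey.
rewrite lee_fin; apply/ler_addgt0Pr => e e0.
have e2 : 0 < e / 2 by rewrite divr_gt0.
have en n : 0 < e / 2 / 2 ^+ n.+1 by rewrite divr_gt0// exprn_gt0.
have /choice[B BP] n := enlarged_box d0 (ab n) (en n).
have [W [Wo bW We]] := boundary_cube_thin c L oo sb e2.
have [N cubeN] : exists N, closure omega `&` cube c L `<=` W `|` \bigcup_(n in `I_N) B n.
  apply: (@compact_set_induction 'rV[R]_d (closure omega `&` cube c L)
    (fun A => exists N, A `<=` W `|` \bigcup_(n in `I_N) B n)).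
  - by rewrite setIC; apply: compact_closedI; [exact: cube_compact|exact: closed_closure].
  - by exists 0%N.
  - by move=> A A' AA' [N AN]; exists N; exact: subset_trans AN.
  - move=> A A' [N AN] [N' AN']; exists (maxn N N') => x [/AN|/AN'] [Wx|[n /= nN Bx]].
    + by left.
    + by right; exists n => //=; rewrite (leq_trans nN)// leq_maxl.
    + by left.
    + by right; exists n => //=; rewrite (leq_trans nN)// leq_maxr.
  move=> p [clp pc]; have [op|nop] := pselect (omega p).
    have [n _ pn] := cov p (conj op pc); have [Bo aB _] := BP n.
    exists (B n); split=> //; first exact: aB.
    by exists n.+1 => x [Bx _]; right; exists n => /=.
  exists W; split=> //; last by exists 0%N => x [Wx _]; left.
  by apply: bW; split=> //; split=> //; rewrite (_ : omega° = omega)//; exact/interior_id.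
have dens : density_le (omega `&` cube c L)
    (e / 2 + \sum_(n < N) (v n + e / 2 / 2 ^+ n.+1)).
  apply: (@density_leS _ _ _ (W `|` \bigcup_(n in `I_N) B n) _ _ _ (lexx _)).
    by move=> x [ox xc]; apply: cubeN; split=> //; exact: subset_closure.
  apply: (density_leU We).
  by apply: (density_le_bigcup (s := fun n => v n + e / 2 / 2 ^+ n.+1)) => n; case: (BP n).
apply: (le_trans (gP _ dens)); rewrite big_split/= [e in leRHS]splitr.
have geo : \sum_(n < N) e / 2 / 2 ^+ n.+1 = e / 2 * (1 - 2 ^- N).
  elim: (N) => [|M ih]; first by rewrite big_ord0 expr0 invr1 subrr mulr0.
  by rewrite big_ord_recr/= ih exprS; field; rewrite expf_neq0.
have sN : \sum_(n < N) v n <= s by rewrite -lee_fin.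
have : 0 < 2 ^- N :> R by rewrite invr_gt0 exprn_gt0.
rewrite geo; nra.
Qed.

End Covering.

Theorem theorem5p4 (R : realType) (d : nat) (d_gt0 : (0 < d)%N)
  (omega : set 'rV[R]_d) (omega_open : open omega)
  (omega_smooth : smooth_boundary omega)
  (V : 'rV[R]_d -> R) (V_cont : continuous V) (V_bounded : bounded_fun V)
  (observability :
    exists T h0 C : R, [/\ 0 < T, 0 < h0, 0 < C &
      forall h : R, 0 < h <= h0 ->
      forall uF : 'rV[R]_d -> R[i], in_l2 h uF ->
      forall u : R -> 'rV[R]_d -> R[i], is_solution h V T uF u ->
        observable h omega T C u]) :
  thick omega.
Proof.
have [T [h0 [C [T0 h00 C0 obs]]]] := observability.
have [L [g [h1 [L0 g0 h10 dens]]]] := observable_density V_bounded T0 h00 C0 obs.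
have LD : 0 < L ^+ d by rewrite exprn_gt0.
exists L, (Num.min 1 (g / L ^+ d)); split=> //.
  by rewrite lt_min ltr01 divr_gt0//= ge_min lexx.
move=> c; apply: (@le_trans _ _ g%:E).
  by rewrite lee_fin -ler_pdivlMr// ge_min lexx orbT.
apply: density_le_lebesgue_vol => // s [e e0 se].
pose h := Num.min h1 (e / 2).
have hpos : 0 < h by rewrite lt_min h10 divr_gt0.
have he : 0 < h < e.
  rewrite hpos/=; have : h <= e / 2 by rewrite ge_min lexx orbT.
  by lra.
have hh1 : 0 < h <= h1 by rewrite hpos ge_min lexx.
have := le_trans (dens h c hh1) (se h he).
by rewrite lee_fin ler_pM2r// invr_gt0 exprn_gt0.
Qed.
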